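(* Let $s\ge 3$ and $t\ge 3$ be integers. Let $S_{2,t}$ be the $3$-graph with vertex set $\{1,2,\dots,t+2\}$ and edge set $\{\{1,2,j\}: 3\le j\le t+2\}$. Let $H$ be a perfect $3$-graph with $s$ vertices. Then the disjoint union $F=S_{2,t}\sqcup H$ is perfect, i.e. $\pi_\lambda(F)=3!\,\lambda(K^3_{s+t+1})$.
   Context: An $r$-graph $G$ is a finite vertex set $V(G)$ with an edge set $E(G)$ of $r$-element subsets of $V(G)$. For an $r$-graph $G$ on vertex set $[n]$ and $\vec x=(x_1,\dots,x_n)\in[0,\infty)^n$, set $\lambda(G,\vec x)=\sum_{e\in E(G)}\prod_{i\in e}x_i$; the Lagrangian of $G$ is $\lambda(G)=\max\{\lambda(G,\vec x): x_i\ge 0,\ \sum_i x_i=1\}$. $K^r_m$ denotes the complete $r$-graph on $m$ vertices. A graph $G$ is $F$-free if it contains no subgraph isomorphic to $F$. The Lagrangian density of an $r$-graph $F$ is $\pi_\lambda(F)=\sup\{r!\,\lambda(G): G \text{ is an } F\text{-free } r\text{-graph}\}$. An $r$-graph $H$ with $m$ vertices is called perfect if $\pi_\lambda(H)=r!\,\lambda(K^r_{m-1})$. $G\sqcup H$ denotes the vertex-disjoint union of $G$ and $H$. *)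

(* Defs.v *)
From HB Require Import structures.
From mathcomp Require Import boolp classical_sets reals.
From mathcomp Require Import all_boot all_order all_algebra.

Set Implicit Arguments.
Unset Strict Implicit.
Unset Printing Implicit Defensive.

Import Order.TTheory GRing.Theory Num.Theory.
Local Open Scope ring_scope.

Record hypergraph (r : nat) := Hypergraph {
  vert :> finType;
  edges : {set {set vert}};
  edge_card : forall e, e \in edges -> #|e| = r }.

Arguments vert {r} _.
Arguments edges {r} _.

Definition lagr (R : realType) (r : nat) (G : hypergraph r) (x : G -> R) : R :=
  \sum_(e in edges G) \prod_(i in e) x i.

Definition simplex (R : realType) (T : finType) : set (T -> R) :=
  [set x | (forall i, 0 <= x i) /\ \sum_i x i = 1]%classic.

(* The supremum is a maximum when G has a vertex, the simplex being compact;
   for G without vertices the simplex is empty and the value is 0. *)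
Definition lagrangian (R : realType) (r : nat) (G : hypergraph r) : R :=
  sup [set lagr x | x in @simplex R G]%classic.

(* An injection carrying edges to edges is an isomorphism onto the subgraph
   consisting of its image vertices and edges; see containsP. *)
Definition contains (r : nat) (G F : hypergraph r) : Prop :=
  exists f : F -> G, injective f /\
    forall e : {set F}, e \in edges F -> f @: e \in edges G.

Definition hfree (r : nat) (F G : hypergraph r) : Prop := ~ contains G F.

Lemma containsP (r : nat) (G F : hypergraph r) :
  contains G F <->
  exists (V : {set G}) (E : {set {set G}}),
    [/\ E \subset edges G, (forall e, e \in E -> e \subset V) &
      exists f : F -> G, [/\ injective f, f @: [set: F] = V &
        [set f @: (e : {set F}) | e in edges F] = E]].
Proof.
split=> [[f [fI fE]] | [V [E [EG _ [f [fI _ fE]]]]]].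
  exists (f @: [set: F]), [set f @: (e : {set F}) | e in edges F].
  split; last by exists f.
    by apply/subsetP=> _ /imsetP[e eF ->]; apply: fE.
  by move=> _ /imsetP[e _ ->]; apply: imsetS; apply: subsetT.
exists f; split=> // e eF; apply: (subsetP EG); rewrite -fE.
exact: imset_f.
Qed.

(* The values r! lambda(G) all lie in [0, 1], and the vertexless hypergraph is
   F-free as soon as F has a vertex: then this is a genuine supremum. *)
Definition lagrangian_density (R : realType) (r : nat) (F : hypergraph r) : R :=
  sup [set y | exists2 G : hypergraph r, hfree F G &
                 y = r`!%:R * lagrangian R G]%classic.

Lemma complete_hypergraph_card (r m : nat) (e : {set 'I_m}) :
  e \in [set e : {set 'I_m} | #|e| == r] -> #|e| = r.
Proof. by rewrite inE => /eqP. Qed.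

Definition complete_hypergraph (r m : nat) : hypergraph r :=
  Hypergraph (@complete_hypergraph_card r m).

Definition perfect_hypergraph (R : realType) (r : nat) (H : hypergraph r) : Prop :=
  lagrangian_density R H =
    r`!%:R * lagrangian R (complete_hypergraph r #|H|.-1).

Section DisjointUnion.
Variables (r : nat) (G H : hypergraph r).

Definition disjoint_union_edges : {set {set (G + H)%type}} :=
  [set inl @: (e : {set G}) | e in edges G] :|:
  [set inr @: (e : {set H}) | e in edges H].

Lemma disjoint_union_card e : e \in disjoint_union_edges -> #|e| = r.
Proof.
by case/setUP=> /imsetP[e' He' ->]; rewrite card_imset ?(edge_card He') //;
  move=> ? ? [].
Qed.

Definition disjoint_union : hypergraph r := Hypergraph disjoint_union_card.
End DisjointUnion.

(* The vertices 1, 2, ..., t+2 are numbered 0, 1, ..., t+1 here. *)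
Definition S2_edges (t : nat) : {set {set 'I_t.+2}} :=
  [set [set inord 0; inord 1; j] | j : 'I_t.+2 & (2 <= j)%N].

Lemma S2_card (t : nat) e : e \in S2_edges t -> #|e| = 3.
Proof.
case/imsetP=> j; rewrite inE => j2 ->.
rewrite -setUA cardsU1 cards2 !inE -!val_eqE /= !inordK //.
by case: (val j) j2 => [|[|k]].
Qed.

Definition S2 (t : nat) : hypergraph 3 := Hypergraph (@S2_card t).

(* Main.v *)
Require Import Defs.
From mathcomp Require Import boolp classical_sets reals.
From mathcomp Require Import all_boot all_order all_algebra.
From mathcomp Require Import ring lra zify.
From mathcomp Require Import topology normedtype derive.

(* Write c(k) = (1 - 1/k)(1 - 2/k) for 6 times the Lagrangian of K_k, m = s + t + 1, and
   suppose that c, which is 6 times the Lagrangian of G, exceeds c(m).  Take optimal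
   weights x, so that every vertex of positive weight has the same link weight c.
   Removing a vertex of weight at most 1/k from a graph of density above c(k)
   leaves density above c(k - 1), so light vertices can be peeled off one at a time.
   Peeled vertices serve as leaves of the star once its centre u, v is fixed and G is
   restricted to the common neighbourhood N of u, v.
   With u heaviest and v chosen by averaging, an inclusion-exclusion over the number of
   vertices of a random triple lying outside N bounds the density lost on passing to N.
   This loss may exceed that of two vertices of weight 1/m, but only when the sum of
   squares of the weights is small; then N has many light vertices, and peeling the
   first three of them (keeping the weights) costs little enough to restore c(m - 5).
   Peeling t - 3 further vertices leaves density above c(s - 1), which forces a copy of
   the perfect graph H inside N, disjoint from u, v and the t leaves. *)

Set Implicit Arguments.
Unset Strict Implicit.
Unset Printing Implicit Defensive.

Import Order.TTheory GRing.Theory Num.Theory.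
Import numFieldNormedType.Exports.
Local Open Scope ring_scope.

(** * Real inequalities *)

Section Inequalities.
Variable R : realFieldType.
Implicit Types (A b c e eta k p q s w y z H M : R).

(* [bracket_ge] with [A = k + 5] and [z = (1 - p) / A], denominators cleared: the
   difference of the two sides is [p] times a polynomial in [k] whose
   coefficients are nonnegative for [0 <= p <= 1]. *)
Lemma bracket_poly k p : 0 <= k -> 0 <= p <= 1 ->
  2 * (k + 4) ^+ 3 * (k + 1) * k * (k + 5 - 3 * (1 - p)) ^+ 2 * (k + 5 - 2 * (1 - p)) <=
  (3 * (k + 5) * (k + 4) ^+ 3 + 6 * (k + 5 - (1 - p)) * (k + 4)
    - (k + 6) * (k + 7) * (k + 5 - (1 - p)) ^+ 2)
  * (k + 5 - 4 * (1 - p)) * (k + 5 - 5 * (1 - p)) * (k + 2) ^+ 2.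
Proof.
move=> k0 /andP[p0 p1]; rewrite -subr_ge0.
have -> : (3 * (k + 5) * (k + 4) ^+ 3 + 6 * (k + 5 - (1 - p)) * (k + 4)
    - (k + 6) * (k + 7) * (k + 5 - (1 - p)) ^+ 2)
  * (k + 5 - 4 * (1 - p)) * (k + 5 - 5 * (1 - p)) * (k + 2) ^+ 2
  - 2 * (k + 4) ^+ 3 * (k + 1) * k * (k + 5 - 3 * (1 - p)) ^+ 2 * (k + 5 - 2 * (1 - p))
  = p * (((76 * 100 + 80) + (244 * 100 + 80) * p - (258 * 100) * p ^+ 2 - (33 * 100 + 60) * p ^+ 3)
       + ((229 * 100 + 44) + (361 * 100 + 92) * p - (444 * 100 + 36) * p ^+ 2 - (44 * 100) * p ^+ 3) * k
       + ((244 * 100 + 56) + (162 * 100 + 36) * p - (300 * 100 + 22) * p ^+ 2 - (19 * 100 + 60) * p ^+ 3) * k ^+ 2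
       + ((125 * 100 + 52) + 804 * p - (96 * 100 + 47) * p ^+ 2 - 340 * p ^+ 3) * k ^+ 3
       + ((33 * 100 + 54) - (11 * 100 + 85) * p - (14 * 100 + 66) * p ^+ 2 - 20 * p ^+ 3) * k ^+ 4
       + (450 - 294 * p - 85 * p ^+ 2) * k ^+ 5
       + (24 - 21 * p) * k ^+ 6) by ring.
have p2 : 0 <= p ^+ 2 <= p by rewrite sqr_ge0 /= expr2; nra.
have p3 : 0 <= p ^+ 3 <= p.
  by case/andP: p2 => p20 p21; rewrite exprSr; apply/andP; split; nra.
have ? i : 0 <= k ^+ i by apply: exprn_ge0.
apply: mulr_ge0 => //.
by do 6 (apply: addr_ge0; last (apply: mulr_ge0 => //; lra)); lra.
Qed.

(* If [u, v] has codegree [1 / H] in optimal weights of density [c], then [bracket c H z]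
   bounds from below the density of the common neighbourhood of [u, v], where [z] is the
   sum of the squares of the weights renormalised on that neighbourhood. *)
Definition bracket c H z := c * (3 - H) * H ^+ 2 / 2 - 3 / 2 * (H - 1) * (1 - z).

(* Here [A = m - 2].  Equality holds at [z = 1 / A], [H = (A + 2) / A], that is,
   when the graph is the complete graph on [m] vertices. *)
Lemma bracket_ge A H z : 5 <= A -> 0 <= z -> z * A <= 1 -> 1 <= H ->
  H <= (A + 2) * (1 - z) / (A - 1) ->
  (A - 4) * (A - 5) * (1 - 3 * z) ^+ 2 * (1 - z) * (1 - 2 * z) <=
  bracket ((A + 1) * A / (A + 2) ^+ 2) H z * (1 - 4 * z) * (1 - 5 * z) * (A - 3) ^+ 2.
Proof.
move=> A5 z0 zA H1 HH; set c := (A + 1) * A / (A + 2) ^+ 2.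
set K := (A + 2) * (1 - z) / (A - 1) in HH.
have A1 : A - 1 != 0 by lra.
have A2 : A + 2 != 0 by lra.
have z5 : z * 5 <= 1 by nra.
have cz : c <= 1 - z.
  rewrite /c ler_pdivrMr; last by rewrite exprn_gt0 //; lra.
  have : z * A ^+ 2 <= A by rewrite expr2 mulrA; nra.
  by nra.
have c0 : 0 <= c by rewrite /c mulr_ge0 ?invr_ge0 ?sqr_ge0 // mulr_ge0; lra.
(* Since [c <= 1 - z], [bracket] is nonincreasing in [H >= 1], so the largest admissible value [K]
   is the worst case. *)
have mono : bracket c K z <= bracket c H z.
  rewrite -subr_ge0.
  have -> : bracket c H z - bracket c K z
   = (K - H) * (3 / 2 * (1 - z) - c / 2 * (3 - ((H - 1) ^+ 2 + (H - 1) * (K - 1) + (K - 1) ^+ 2))).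
    by rewrite /bracket; field.
  apply: mulr_ge0; first by lra.
  have : 0 <= (H - 1) ^+ 2 + (H - 1) * (K - 1) + (K - 1) ^+ 2 by nra.
  by nra.
have pos : 0 <= (1 - 4 * z) * (1 - 5 * z) * (A - 3) ^+ 2.
  by rewrite !mulr_ge0 ?sqr_ge0 //; lra.
rewrite -[leLHS]mulrA -[leLHS]mulrA -[leLHS]mulrA -[leRHS]mulrA -[leRHS]mulrA.
rewrite (mulrA (1 - 4 * z)).
apply: le_trans (ler_wpM2r pos mono); rewrite -(mulrA (1 - 4 * z)).
have k0 : 0 <= A - 5 by lra.
have p01 : 0 <= 1 - z * A <= 1 by apply/andP; split; nra.
have := @bracket_poly (A - 5) (1 - z * A) k0 p01.
have Apos : 0 < (1 - z) / (2 * A ^+ 3 * (A - 1) ^+ 3).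
  apply: divr_gt0; first by lra.
  by rewrite !mulr_gt0 ?exprn_gt0 //; lra.
move=> /(ler_wpM2r (ltW Apos)) h.
have A0 : A != 0 by lra.
have A12 : A ^+ 2 != 0 by rewrite expf_neq0.
have e1 : (A - 4) * ((A - 5) * ((1 - 3 * z) ^+ 2 * ((1 - z) * (1 - 2 * z)))) = 
 2 * (A - 5 + 4) ^+ 3 * (A - 5 + 1) * (A - 5) *
      (A - 5 + 5 - 3 * (1 - (1 - z * A))) ^+ 2 *
      (A - 5 + 5 - 2 * (1 - (1 - z * A))) * ((1 - z) / (2 * A ^+ 3 * (A - 1) ^+ 3)).
  by field; rewrite A0 A1.
have e2 : bracket c K z * ((1 - 4 * z) * ((1 - 5 * z) * (A - 3) ^+ 2)) =
 (3 * (A - 5 + 5) * (A - 5 + 4) ^+ 3 +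
       6 * (A - 5 + 5 - (1 - (1 - z * A))) * (A - 5 + 4) -
       (A - 5 + 6) * (A - 5 + 7) * (A - 5 + 5 - (1 - (1 - z * A))) ^+ 2) *
      (A - 5 + 5 - 4 * (1 - (1 - z * A))) *
      (A - 5 + 5 - 5 * (1 - (1 - z * A))) * (A - 5 + 2) ^+ 2 *
      ((1 - z) / (2 * A ^+ 3 * (A - 1) ^+ 3)).
  by rewrite /bracket /c /K; field; rewrite A0 A1 A2.
by rewrite e1 e2.
Qed.

(** Supplies the two hypotheses on [q] of [three_leaves]. In the application [b = 1 / m], [M] is the
    weight of the heaviest vertex [u], [eta] the codegree of [u, v] and [q] the sum of squares on
    their common neighbourhood. The key is [M * (1 - M) <= b * (1 - b)]. *)
Lemma region_light b c M eta q : 0 < b -> b * 7 <= 1 -> (1 - b) * (1 - 2 * b) < c ->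
  0 <= M <= b -> 0 < eta -> q <= M * eta -> c <= (1 - M) * eta ->
  q * (1 - 2 * b) < b * eta ^+ 2 /\ q <= eta ^+ 2 - (1 - 3 * b) * eta.
Proof.
move=> b0 b7 hc /andP[M0 Mb] e0 qM cM; split.
  have h : M * (1 - 2 * b) < b * eta.
    have h0 : 0 <= (b - M) * (1 - b - M) by apply: mulr_ge0; lra.
    have h1 : M * (1 - M) <= b * (1 - b) by nra.
    have h2 : (1 - b) * (1 - 2 * b) < (1 - M) * eta by lra.
    rewrite -(@ltr_pM2l _ (1 - M)); last by lra.
    have -> : (1 - M) * (M * (1 - 2 * b)) = M * (1 - M) * (1 - 2 * b) by ring.
    have h3 : M * (1 - M) * (1 - 2 * b) <= b * (1 - b) * (1 - 2 * b) by apply: ler_wpM2r; lra.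
    have h4 : b * ((1 - b) * (1 - 2 * b)) < b * ((1 - M) * eta) by rewrite ltr_pM2l.
    by nra.
  have : q * (1 - 2 * b) <= M * eta * (1 - 2 * b) by apply: ler_wpM2r => //; lra.
  have : M * (1 - 2 * b) * eta < b * eta * eta by rewrite ltr_pM2r.
  by rewrite expr2; lra.
have h : M <= eta - (1 - 3 * b).
  have h1 : 0 <= (b - M) * (2 * b - M) by apply: mulr_ge0; lra.
  have h2 : (1 - M) * (1 - 3 * b + M) <= (1 - M) * eta by nra.
  by move: h2; rewrite ler_pM2l; lra.
have : M * eta <= (eta - (1 - 3 * b)) * eta by apply: ler_wpM2r => //; lra.
by rewrite expr2; lra.
Qed.

(** The counterpart of [region_light] for [M] at least [b], with [y] the weight of [v] and [s] the
    sum of squares off [u]. Replacing [M] by [b], or by [y] when [y > b], in the averaging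
    inequality bounds [q] in terms of [eta] alone. *)
Lemma region_heavy b c M eta q y s : 0 < b -> b * 7 <= 1 -> (1 - b) * (1 - 2 * b) < c ->
  b <= M -> 0 <= y <= M -> 0 < eta -> q <= s - y ^+ 2 ->
  c + s <= (1 - M) * (eta + y) -> eta + y <= 1 - M -> 0 <= q ->
  q * (1 - 2 * b) < b * eta ^+ 2 /\ q <= eta ^+ 2 - (1 - 3 * b) * eta.
Proof.
move=> b0 b7 hc bM /andP[y0 yM] e0 qs cs ey q0.
have B1 : 0 < 1 - 2 * b by lra.
have [le_e|lt_e] := leP (1 - 2 * b) eta.
  have yb : y <= b by lra.
  have h1 : (1 - M) * (eta + y) <= (1 - b) * (eta + y) by apply: ler_wpM2r; lra.
  have h2 : 0 <= (1 - b - eta - y) * (1 - b - y - (1 - b - eta)) by apply: mulr_ge0; lra.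
  have h3 : q < b * (1 - b) - (1 - b - eta) ^+ 2 by nra.
  have h4 : q * (1 - 2 * b) < (b * (1 - b) - (1 - b - eta) ^+ 2) * (1 - 2 * b).
    by rewrite ltr_pM2r.
  have h5 : 0 <= (1 - b) * (eta - (1 - 2 * b)) ^+ 2 by rewrite mulr_ge0 ?sqr_ge0 //; lra.
  have h6 : q * (1 - 2 * b) < b * eta ^+ 2 by move: h4 h5; nra.
  split=> //.
  have h7 : 0 <= (1 - 3 * b) * (eta - (1 - 2 * b)) * eta by rewrite !mulr_ge0 //; lra.
  by rewrite -(ler_pM2r B1); nra.
(* Both conclusions follow from this linear bound: its gap to the second is
   [(eta - (1 - 2 * b)) ^+ 2], and its gap to the first, after scaling by [1 - 2 * b], is the
   product in [h3]. Equality [eta = 1 - 2 * b] is the complete graph. *)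
have h : q < (1 - b) * eta - (1 - 2 * b) ^+ 2.
  have [yb|by_] := leP y b.
    have h1 : (1 - M) * (eta + y) <= (1 - b) * (eta + y) by apply: ler_wpM2r; lra.
    have h2 : 0 <= (b - y) * (1 - b - b - y) by apply: mulr_ge0; lra.
    by nra.
  have h1 : (1 - M) * (eta + y) <= (1 - y) * (eta + y) by apply: ler_wpM2r; lra.
  have h2 : (1 - b) * (1 - 2 * b) + y ^+ 2 <= (1 - y) * (eta + y) by lra.
  have h3 : 1 - eta <= 2 * (y + b).
    have h4 : (1 - y) * (1 - 2 * b - y) <= (1 - y) * eta by nra.
    by move: h4; rewrite ler_pM2l; lra.
  have h5 : 0 <= (y - b) * (2 * (y + b) - (1 - eta)) by apply: mulr_ge0; lra.
  by nra.
have h1 : 0 <= (eta - (1 - 2 * b)) ^+ 2 by rewrite sqr_ge0.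
have e2 : 2 * b < eta.
  rewrite ltNge; apply/negP => ?.
  have : q < (1 - b) * (2 * b) - (1 - 2 * b) ^+ 2 by nra.
  by nra.
split; last by nra.
have h2 : q * (1 - 2 * b) < ((1 - b) * eta - (1 - 2 * b) ^+ 2) * (1 - 2 * b) by rewrite ltr_pM2r.
have h3 : 0 <= ((1 - 2 * b) - eta) * ((1 - 2 * b) ^+ 2 - b * eta).
  by apply: mulr_ge0; nra.
by move: h2 h3; nra.
Qed.

(* Removing a vertex of weight [z] from optimal weights and renormalising multiplies the
   density by [leaf z]. *)
Definition leaf z := (1 - 3 * z) / (1 - z) ^+ 3.

Lemma leaf_gt0 z : 3 * z < 1 -> 0 < leaf z.
Proof. by move=> z3; rewrite divr_gt0 ?exprn_gt0; lra. Qed.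

Lemma leaf_le z w : 0 <= w -> w <= z -> 3 * z < 1 -> leaf z <= leaf w.
Proof.
move=> w0 wz z3; rewrite /leaf ler_pdivrMr; last by rewrite exprn_gt0 //; lra.
rewrite mulrAC ler_pdivlMr; last by rewrite exprn_gt0 //; lra.
rewrite -subr_ge0.
have -> : (1 - 3 * w) * (1 - z) ^+ 3 - (1 - 3 * z) * (1 - w) ^+ 3 = 
  (z - w) * (3 * (z + w) - (z ^+ 2 + z * w + w ^+ 2) - 9 * z * w + 3 * z * w * (z + w)) by ring.
apply: mulr_ge0; first by lra.
nra.
Qed.

(** The arguments of [leaf] are the iterates of [z / (1 - z)], which bound the sum of squares after
    each deletion; the three factors telescope to [GE], and [bracket_ge] concludes. With
    [m = A + 2], the left side is [clique_dens (m - 5)]. *)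
Lemma three_leaves A c eta q e (b := (A + 2)^-1) (z := q / eta ^+ 2) :
  5 <= A -> (1 - b) * (1 - 2 * b) < c -> 0 < eta <= 1 -> 0 <= q ->
  q * (1 - 2 * b) < b * eta ^+ 2 -> q <= eta ^+ 2 - (1 - 3 * b) * eta ->
  c * (1 - 3 / 2 * (1 - eta)) - 3 / 2 * (1 - eta) * (eta ^+ 2 - q) <= e ->
  [/\ 0 <= z, 5 * z < 1 &
  (A - 4) * (A - 5) / (A - 3) ^+ 2 <
  e / eta ^+ 3 * leaf z * leaf (z / (1 - z)) * leaf (z / (1 - 2 * z))].
Proof.
move=> A5 hc /andP[e_0 e_1] q0 qlt qle he.
have eN : eta != 0 by rewrite gt_eqF.
have A1 : A - 1 != 0 by lra.
have A2 : A + 2 != 0 by lra.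
have A3 : A - 3 != 0 by lra.
have e2 : 0 < eta ^+ 2 by rewrite exprn_gt0.
have e3 : 0 < eta ^+ 3 by rewrite exprn_gt0.
have b0 : 0 < b by rewrite invr_gt0; lra.
have bA : b * (A + 2) = 1 by rewrite mulVf.
have b7 : b * 7 <= 1 by nra.
have qA : q * A < eta ^+ 2.
  have -> : q * A = q * (1 - 2 * b) * (A + 2) by rewrite /b; field.
  have -> : eta ^+ 2 = b * eta ^+ 2 * (A + 2) by rewrite /b; field.
  by rewrite ltr_pM2r //; lra.
have z0 : 0 <= z by rewrite divr_ge0 // ltW.
have zA : z * A < 1 by rewrite mulrAC ltr_pdivrMr // mul1r.
have z5 : 5 * z < 1 by nra.
split=> //.
have eta_ge : 1 - 3 * b <= eta.
  have h : 0 <= eta * (eta - (1 - 3 * b)) by rewrite expr2 in qle; lra.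
  by move: h; rewrite pmulr_rge0 //; lra.
have HH : eta^-1 <= (A + 2) * (1 - z) / (A - 1).
  rewrite ler_pdivlMr; last by lra.
  rewrite mulrC ler_pdivrMr //.
  have -> : (A + 2) * (1 - z) * eta = (A + 2) * (eta ^+ 2 - q) / eta by rewrite /z; field.
  rewrite ler_pdivlMr //.
  have -> : A - 1 = (A + 2) * (1 - 3 * b) by rewrite /b; field.
  by rewrite -mulrA ler_pM2l; lra.
have H1 : 1 <= eta^-1 by rewrite invf_ge1.
have := bracket_ge A5 z0 (ltW zA) H1 HH.
set cm := _ / (A + 2) ^+ 2; set B := bracket _ _ _ => hB.
have cmE : cm = (1 - b) * (1 - 2 * b) by rewrite /cm /b; field.
(* [B] is the bound [he] divided by [eta ^+ 3], with [c] lowered to [cm]; [eta_ge] keeps the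
   coefficient of [c] positive. *)
have Blt : B < e / eta ^+ 3.
  rewrite ltr_pdivlMr //; apply: lt_le_trans he.
  have -> : B * eta ^+ 3 = cm * (1 - 3 / 2 * (1 - eta)) - 3 / 2 * (1 - eta) * (eta ^+ 2 - q).
    by rewrite /B /bracket /z; field.
  by rewrite ltrD2r ltr_pM2r ?cmE //; lra.
have z1 : 1 - z != 0 by lra.
have z2 : 1 - 2 * z != 0 by lra.
have z3 : 1 - 3 * z != 0 by lra.
have GE : leaf z * leaf (z / (1 - z)) * leaf (z / (1 - 2 * z)) =
   (1 - 4 * z) * (1 - 5 * z) / ((1 - 3 * z) ^+ 2 * (1 - z) * (1 - 2 * z)).
  by rewrite /leaf; field; rewrite -?andbA; do ?[apply/andP; split]; rewrite gt_eqF //; lra.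
have den : 0 < (1 - 3 * z) ^+ 2 * (1 - z) * (1 - 2 * z).
  by rewrite !mulr_gt0 ?exprn_gt0 //; lra.
have -> : e / eta ^+ 3 * leaf z * leaf (z / (1 - z)) * leaf (z / (1 - 2 * z)) =
  e / eta ^+ 3 * (leaf z * leaf (z / (1 - z)) * leaf (z / (1 - 2 * z))) by rewrite !mulrA.
rewrite GE.
have G0 : 0 < (1 - 4 * z) * (1 - 5 * z) / ((1 - 3 * z) ^+ 2 * (1 - z) * (1 - 2 * z)).
  by rewrite divr_gt0 // mulr_gt0 //; lra.
apply: le_lt_trans (_ : B * ((1 - 4 * z) * (1 - 5 * z) / ((1 - 3 * z) ^+ 2 * (1 - z) * (1 - 2 * z))) < _); last by rewrite ltr_pM2r.
rewrite ler_pdivrMr; last by rewrite exprn_gt0; lra.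
set den' := _ * _ * (1 - 2 * z) in den *.
have -> : B * ((1 - 4 * z) * (1 - 5 * z) / den') * (A - 3) ^+ 2 =
  B * (1 - 4 * z) * (1 - 5 * z) * (A - 3) ^+ 2 / den' by ring.
by rewrite ler_pdivlMr // /den'; move: hB; rewrite !mulrA.
Qed.

End Inequalities.

(** * Weighted densities *)

Section TrilinearForm.
Variables (R : realFieldType) (T : finType) (e : T -> T -> T -> bool).
Implicit Types (f g h x : T -> R) (u v w : T) (S : {set T}).

(** The sum runs over ordered triples, so each edge is counted six times and [tri x x x] is
    [6 * lagr x] (see [dens_lagr]). *)
Definition tri f g h : R :=
  \sum_a \sum_b \sum_c f a * g b * h c * (e a b c)%:R.

Lemma triDl f1 f2 g h : tri (f1 \+ f2) g h = tri f1 g h + tri f2 g h.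
Proof.
rewrite /tri -big_split; apply: eq_bigr => a _; rewrite -big_split.
apply: eq_bigr => b _; rewrite -big_split; apply: eq_bigr => c _ /=.
by rewrite !mulrDl.
Qed.

Lemma triZl k f g h : tri (k \*o f) g h = k * tri f g h.
Proof.
rewrite /tri mulr_sumr; apply: eq_bigr => a _; rewrite mulr_sumr.
apply: eq_bigr => b _; rewrite mulr_sumr; apply: eq_bigr => c _ /=.
by rewrite !mulrA.
Qed.

Lemma eq_tri f g h f' g' h' : f =1 f' -> g =1 g' -> h =1 h' -> tri f g h = tri f' g' h'.
Proof.
move=> ff gg hh; apply: eq_bigr => a _; apply: eq_bigr => b _.
by apply: eq_bigr => c _; rewrite ff gg hh.
Qed.

Lemma tri_ge0 f g h : (forall i, 0 <= f i) -> (forall i, 0 <= g i) ->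
  (forall i, 0 <= h i) -> 0 <= tri f g h.
Proof.
by move=> *; do 3 (apply: sumr_ge0 => ? _); rewrite !mulr_ge0 // ler0n.
Qed.

Definition point w : T -> R := fun i => (i == w)%:R.

Lemma sum_point w (F : T -> R) : \sum_i point w i * F i = F w.
Proof.
rewrite (bigD1 w) //= /point eqxx mul1r big1 ?addr0 // => i /negPf ->.
by rewrite mul0r.
Qed.

Definition codeg x u v := \sum_c x c * (e u v c)%:R.

Lemma tri_point u x g : tri (point u) g x = \sum_v g v * codeg x u v.
Proof.
rewrite -(sum_point u (fun u => \sum_v g v * codeg x u v)).
apply: eq_bigr => a _; rewrite mulr_sumr; apply: eq_bigr => b _.
rewrite !mulr_sumr; apply: eq_bigr => c _; ring.
Qed.

Lemma tri_sum f g h : tri f g h = \sum_u f u * tri (point u) g h.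
Proof.
apply: eq_bigr => a _; rewrite tri_point mulr_sumr.
apply: eq_bigr => b _; rewrite !mulr_sumr; apply: eq_bigr => c _; ring.
Qed.

Hypotheses (e12 : forall a b c, e a b c = e b a c)
  (e23 : forall a b c, e a b c = e a c b) (e_irr : forall a c, e a a c = false).

Lemma tri12 f g h : tri f g h = tri g f h.
Proof.
rewrite /tri exchange_big /=; apply: eq_bigr => b _; apply: eq_bigr => a _.
by apply: eq_bigr => c _; rewrite e12 (mulrC (f a)).
Qed.

Lemma tri23 f g h : tri f g h = tri f h g.
Proof.
rewrite /tri; apply: eq_bigr => a _; rewrite exchange_big /=.
by apply: eq_bigr => c _; apply: eq_bigr => b _; rewrite e23 (mulrAC (f a)).
Qed.

Lemma triDm f g1 g2 h : tri f (g1 \+ g2) h = tri f g1 h + tri f g2 h.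
Proof. by rewrite tri12 triDl (tri12 g1) (tri12 g2). Qed.

Lemma triDr f g h1 h2 : tri f g (h1 \+ h2) = tri f g h1 + tri f g h2.
Proof. by rewrite tri23 triDm (tri23 _ h1) (tri23 _ h2). Qed.

Definition dens x := tri x x x.

Lemma densD f g : dens (f \+ g) = dens f + 3 * tri g f f + 3 * tri g g f + dens g.
Proof.
rewrite /dens !(triDl, triDm, triDr) (tri12 f g f) (tri23 f f g) (tri12 f g f).
by rewrite (tri12 f g g) (tri23 g f g); ring.
Qed.

Lemma densZ k f : dens (k \*o f) = k ^+ 3 * dens f.
Proof. by rewrite /dens triZl tri12 triZl tri23 tri12 triZl !mulrA !exprS expr0 mulr1 !mulrA. Qed.

Lemma tri_point2 w f : tri (point w) (point w) f = 0.
Proof.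
rewrite tri_point sum_point; apply: big1 => c _.
by rewrite e_irr mulr0.
Qed.

(** No edge repeats a vertex, so the terms of degree two and three in [k] vanish. *)
Lemma dens_add_point x w k :
  dens (x \+ (k \*o point w)) = dens x + 3 * k * tri (point w) x x.
Proof.
rewrite densD densZ !triZl (tri12 (point w) (k \*o _)) triZl /dens !tri_point2; ring.
Qed.

(** Written as a perturbation along [point w], so that [dens_add_point] applies. *)
Definition del x w := x \+ (- x w \*o point w).

Lemma delE x w i : del x w i = if i == w then 0 else x i.
Proof. by rewrite /del /point /=; case: eqP => [->|_]; rewrite ?mulr1 ?mulr0 ?subrr ?addr0. Qed.

Lemma sum_del x w : \sum_i del x w i = \sum_i x i - x w.
Proof.
rewrite big_split /= -mulr_sumr -[X in _ + - x w * X]/(\sum_i point w i).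
have -> : \sum_i point w i = 1.
  by rewrite -[RHS](sum_point w (fun=> 1)); apply: eq_bigr => i _; rewrite mulr1.
by rewrite mulr1.
Qed.

Lemma dens_del x w : dens (del x w) = dens x - 3 * (x w * tri (point w) x x).
Proof. by rewrite dens_add_point; ring. Qed.

(** Weights remain functions on all of [T]: passing to a vertex subset changes the support, not the
    type. *)
Definition weight S x :=
  [/\ forall i, 0 <= x i, forall i, i \notin S -> x i = 0 & \sum_i x i = 1].

Definition sqsum x := \sum_i x i ^+ 2.

Lemma cauchy_sum S f : (\sum_(i in S) f i) ^+ 2 <= #|S|%:R * \sum_(i in S) f i ^+ 2.
Proof.
set s := \sum_(i in S) f i; set n := #|S|%:R.
have [S0|S0] := eqVneq S set0.
  by rewrite /s /n S0 !big_set0 expr0n /= mulr0.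
have n0 : 0 < n by rewrite ltr0n card_gt0.
have : 0 <= \sum_(i in S) (n * f i - s) ^+ 2 by apply: sumr_ge0 => i _; apply: sqr_ge0.
under eq_bigr => i _.
  have -> : (n * f i - s) ^+ 2 = n ^+ 2 * f i ^+ 2 + - (2 * n * s) * f i + s ^+ 2 by ring.
  over.
rewrite !big_split /= -!mulr_sumr sumr_const -/s -mulr_natl -/n.
set q := \sum_(i in S) _; rewrite (_ : _ + _ = n * (n * q - s ^+ 2)); last by ring.
by rewrite pmulr_rge0 // subr_ge0.
Qed.

Lemma sum_support S x (F : T -> R) : weight S x -> (forall i, x i = 0 -> F i = 0) ->
  \sum_(i in S) F i = \sum_i F i.
Proof.
move=> [_ xS _] F0; rewrite [RHS](bigID (mem S)) /= [X in _ + X]big1 ?addr0 // => i iS.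
by rewrite F0 // xS.
Qed.

Lemma weight_neq0 S x : weight S x -> exists w, w \in S.
Proof.
move=> [x0 xS x1]; apply/set0Pn/eqP => S0; have := x1; rewrite big1 => [/esym/eqP|i _].
  by rewrite oner_eq0.
by rewrite xS // S0 inE.
Qed.

Lemma cauchy_support S x : weight S x -> 1 <= #|S|%:R * sqsum x.
Proof.
move=> wx; have [_ _ x1] := wx; have := cauchy_sum S x.
rewrite (sum_support wx) // x1 expr1n (sum_support wx) // => i ->.
by rewrite expr0n.
Qed.

(** The variance of [x i], when [i] is drawn with probability [x i], is nonnegative. *)
Lemma cubesum_ge S x : weight S x -> sqsum x ^+ 2 <= \sum_i x i ^+ 3.
Proof.
move=> [x0 xS x1]; set Q := sqsum x.
have : 0 <= \sum_i x i * (x i - Q) ^+ 2.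
  by apply: sumr_ge0 => i _; rewrite mulr_ge0 // sqr_ge0.
under eq_bigr => i _.
  have -> : x i * (x i - Q) ^+ 2 = x i ^+ 3 + - (2 * Q) * x i ^+ 2 + Q ^+ 2 * x i by ring.
  over.
rewrite !big_split /= -!mulr_sumr x1 -/(sqsum x) -/Q; lra.
Qed.

(* Average [dens (del x w)] against [(1 - x w) ^ 3], uniformly over [w \in S]. *)
Lemma exists_leaf S x z : weight S x -> 0 < dens x -> sqsum x <= z -> 3 * z < 1 ->
  exists2 w, w \in S & dens x * leaf z * (1 - x w) ^+ 3 <= dens (del x w).
Proof.
move=> wx d0 Qz z3; have [x0 xS x1] := wx.
case: (pickP [pred w | (w \in S) && (dens x * leaf z * (1 - x w) ^+ 3 <= dens (del x w))])
  => [w /andP[]|H]; first by exists w.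
exfalso.
set n : R := #|S|%:R; set Q := sqsum x in Qz *.
have [w0 w0S] := weight_neq0 wx.
have cubeE : \sum_(w in S) (1 - x w) ^+ 3 = n - 3 + 3 * Q - \sum_i x i ^+ 3.
  under eq_bigr => i _.
    have -> : (1 - x i) ^+ 3 = 1 + - 3 * x i + 3 * x i ^+ 2 + - 1 * x i ^+ 3 by ring.
    over.
  rewrite !big_split /= -!mulr_sumr sumr_const !(sum_support wx) ?x1 => [|i ->|i ->|i ->] //;
    rewrite ?expr0n //.
  by rewrite -/n /Q /sqsum; ring.
have : \sum_(w in S) dens (del x w) < \sum_(w in S) dens x * leaf z * (1 - x w) ^+ 3.
  apply: ltr_sum; first by apply/hasP; exists w0; rewrite ?mem_index_enum.
  by move=> i iS; have := H i; rewrite /= iS /= => /negbT; rewrite -ltNge.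
rewrite -mulr_sumr.
have -> : \sum_(w in S) dens (del x w) = dens x * (n - 3).
  rewrite (eq_bigr (fun w => dens x - 3 * (x w * tri (point w) x x))); last first.
    by move=> w _; apply: dens_del.
  rewrite sumrB sumr_const -mulr_sumr (sum_support wx) => [|i ->]; last by rewrite mul0r.
  by rewrite -tri_sum -/(dens x) -mulr_natr -/n; ring.
rewrite cubeE.
apply/negP; rewrite -leNgt -mulrA ler_pM2l //.
have nQ : 1 <= n * Q := cauchy_support wx.
have Q0 : 0 < Q.
  by move: nQ; apply: contraTT; rewrite -leNgt -ltNge => Q0; apply: le_lt_trans ltr01; rewrite mulr_ge0_le0 // ler0n.
have P := cubesum_ge wx.
have n3 : 0 < n - 3.
  have Q3 : 3 * Q < 1 by lra.
  by rewrite -(pmulr_lgt0 _ Q0) mulrBl; lra.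
(* Replacing [z] by [Q] and the cubes by their lower bound [Q ^+ 2] leaves a claim equivalent to
   [n * Q >= 1], which is Cauchy-Schwarz. *)
apply: (@le_trans _ _ (leaf Q * (n - 3 + 3 * Q - Q ^+ 2))).
  apply: (@le_trans _ _ (leaf Q * (n - 3 + 3 * Q - \sum_i x i ^+ 3))).
    apply: ler_wpM2r; last by apply: leaf_le => //; lra.
    rewrite -cubeE; apply: sumr_ge0 => i _; apply: exprn_ge0; rewrite subr_ge0 -x1.
    by rewrite (bigD1 i) //= lerDl sumr_ge0.
  apply: ler_wpM2l; first by apply/ltW/leaf_gt0; lra.
  by move: P; rewrite -/Q; lra.
have Q3 : 0 < (1 - Q) ^+ 3 by rewrite exprn_gt0 //; lra.
rewrite /leaf mulrAC ler_pdivrMr //.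
rewrite -subr_ge0.
have -> : (n - 3) * (1 - Q) ^+ 3 - (1 - 3 * Q) * (n - 3 + 3 * Q - Q ^+ 2) =
  Q * (3 - Q) * (n * Q - 1) by ring.
by rewrite !mulr_ge0 //; lra.
Qed.
End TrilinearForm.

(** * Existence of optimal weights *)

Section Maximum.
Variables (R : realType) (T : finType) (e : T -> T -> T -> bool).

Lemma continuous_sum (X : topologicalType) (I : Type) (r : seq I) (F : I -> X -> R) :
  (forall i, continuous (F i)) -> continuous (fun x => \sum_(i <- r) F i x).
Proof.
move=> cF x; elim: r => [|i r IH].
  by under eq_fun do rewrite big_nil; apply: cvg_cst.
by under eq_fun do rewrite big_cons; apply: cvgD; [apply: cF|apply: IH].
Qed.

Lemma continuous_mul (X : topologicalType) (f g : X -> R) :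
  continuous f -> continuous g -> continuous (fun x => f x * g x).
Proof. by move=> cf cg x; apply: cvgM; [apply: cf|apply: cg]. Qed.

(** The weights on [S] form a closed subset of a cube, compact by Tychonoff, and [dens e] is a
    polynomial, hence continuous. *)
Lemma max_weight (S : {set T}) : S != set0%SET ->
  exists2 x : T -> R, weight S x & forall y, weight S y -> dens e y <= dens e x.
Proof.
move=> /set0Pn[w wS].
pose X := prod_topology (fun _ : T => R : topologicalType).
have cproj (i : T) : continuous (fun f : X => f i).
  exact: (@proj_continuous _ (fun _ : T => R : topologicalType) i).
pose box : set X := [set f : X | forall i, `[0, 1]%classic (f i)]%classic.
have cbox : compact box 
  by apply: (@tychonoff T (fun=> R : topologicalType) (fun=> `[0, 1]%classic)) => i;
    apply: segment_compact.
pose A : set X := [set f : X | weight S (f : T -> R)]%classic.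
have Abox : (A `<=` box)%classic.
  move=> f [f0 fS f1] i /=; rewrite in_itv /= f0 /= -f1 (bigD1 i) //= lerDl.
  by apply: sumr_ge0.
have Aclosed : closed A.
  have -> : A = ((\bigcap_(i in [set: T]) ((fun f : X => f i) @^-1` [set t : R | 0 <= t]))
     `&` ((\bigcap_(i in [set i | i \notin S]) ((fun f : X => f i) @^-1` [set 0 : R]))
     `&` ((fun f : X => \sum_i f i) @^-1` [set 1 : R])))%classic.
    apply/seteqP; split=> f /=; first by move=> [f0 fS f1]; split=> // i _; apply: f0.
    by move=> [f0 [fS f1]]; split=> // i; apply: f0.
  apply: closedI; last apply: closedI.
  - apply: closed_bigI => i _; apply: preimage_closed; last exact: closed_ge.
    by move=> f _; apply: cproj.
  - apply: closed_bigI => i _; apply: preimage_closed; last exact: closed_eq.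
    by move=> f _; apply: cproj.
  - apply: preimage_closed; last exact: closed_eq.
    by move=> f _; apply: continuous_sum.
have cA : compact A by apply: subclosed_compact Abox.
have A0 : (A !=set0)%classic.
  exists (point R w); split=> [i|i iS|].
  - by rewrite ler0n.
  - by rewrite /point; case: eqP iS => // ->; rewrite wS.
  - rewrite -[RHS](sum_point w (fun=> 1 : R)).
    by apply: eq_bigr => i _; rewrite mulr1.
have cdens : continuous (dens e : X -> R).
  have c3 a b c : continuous (fun f : X => f a * f b * f c * (e a b c)%:R).
    apply: (@continuous_mul X (fun f => f a * f b * f c) (fun=> (e a b c)%:R)).
      apply: (@continuous_mul X (fun f => f a * f b) (fun f => f c)); last exact: cproj.
      by apply: (@continuous_mul X (fun f => f a) (fun f => f b)); apply: cproj.
    exact: (@cst_continuous X R).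
  have c2 a b : continuous (fun f : X => \sum_c f a * f b * f c * (e a b c)%:R).
    exact: (@continuous_sum X _ _ (fun c f => f a * f b * f c * (e a b c)%:R) (c3 a b)).
  have c1 a : continuous (fun f : X => \sum_b \sum_c f a * f b * f c * (e a b c)%:R).
    exact: (@continuous_sum X _ _ (fun b f => \sum_c f a * f b * f c * (e a b c)%:R) (c2 a)).
  exact: (@continuous_sum X _ _ (fun a f => \sum_b \sum_c f a * f b * f c * (e a b c)%:R) c1).
have [x xA xmax] := compact_EVT_max A0 cA (continuous_subspaceT cdens).
exists x; first exact: (set_mem xA).
by move=> y wy; apply: xmax; apply: mem_set.
Qed.
End Maximum.

(** * Peeling off light vertices *)

Section Optimal.
Variables (R : realType) (T : finType) (e : T -> T -> T -> bool).
Hypotheses (e12 : forall a b c, e a b c = e b a c)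
  (e23 : forall a b c, e a b c = e a c b) (e_irr : forall a c, e a a c = false).
Implicit Types (x y : T -> R) (u v w : T) (S : {set T}).
Local Notation dens := (dens e).
Local Notation codeg := (codeg e).

(* [link x u] is the partial derivative of [dens] at [u], up to the factor [3]. *)
Definition link x u := tri e (point R u) x x.

Lemma link_codeg x u : link x u = \sum_v x v * codeg x u v.
Proof. exact: tri_point. Qed.

Lemma sum_link x : \sum_u x u * link x u = dens x.
Proof. by rewrite /dens tri_sum. Qed.

Lemma dens_ge0 x : (forall i, 0 <= x i) -> 0 <= dens x.
Proof. by move=> x0; apply: tri_ge0. Qed.

Lemma normalize S y : (forall i, 0 <= y i) -> (forall i, i \notin S -> y i = 0) ->
  0 < \sum_i y i -> weight S ((\sum_i y i)^-1 \*o y).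
Proof.
move=> y0 yS s0; split=> [i|i /yS|] /=.
- by rewrite mulr_ge0 // invr_ge0 ltW.
- by move=> ->; rewrite mulr0.
- by rewrite -mulr_sumr mulVf // gt_eqF.
Qed.

Section Max.
Variables (S : {set T}) (x : T -> R).
Hypotheses (wx : weight S x) (xmax : forall y, weight S y -> dens y <= dens x).

Lemma max_dens y : (forall i, 0 <= y i) -> (forall i, i \notin S -> y i = 0) ->
  0 < \sum_i y i -> dens y <= dens x * (\sum_i y i) ^+ 3.
Proof.
move=> y0 yS s0; have := xmax (normalize y0 yS s0).
by rewrite densZ // exprVn mulrC ler_pdivrMr // exprn_gt0.
Qed.

(* By homogeneity [dens (x + k u) <= dens x * (1 + k) ^ 3]; the left side is affine in [k]. *)
Lemma max_link_le u : u \in S -> link x u <= dens x.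
Proof.
move=> uS; have [x0 xS x1] := wx; set L := link x u; set c := dens x.
have c0 : 0 <= c by apply: dens_ge0.
rewrite leNgt; apply/negP => cL.
(* For this [k <= 1] the excess [3 * c * k + c * k ^+ 2] is at most [4 * c * k], which is below
   [3 * (L - c)]. *)
pose k := (L - c) / (2 * (L + 1)).
have k0 : 0 < k by apply: divr_gt0; lra.
have kE : k * (2 * (L + 1)) = L - c by rewrite divfK //; apply: lt0r_neq0; lra.
have k1 : k <= 1 by nra.
have y0 i : 0 <= (x \+ (k \*o point R u)) i.
  by rewrite /= addr_ge0 // mulr_ge0 ?ler0n // ltW.
have yS i : i \notin S -> (x \+ (k \*o point R u)) i = 0.
  move=> iS; rewrite /= xS // /point; case: eqP iS => [->|_ _]; first by rewrite uS.
  by rewrite mulr0 addr0.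
have ys : \sum_i (x \+ (k \*o point R u)) i = 1 + k.
  rewrite big_split /= x1 -mulr_sumr; congr (_ + _).
  rewrite -[RHS](sum_point u (fun=> k)) mulr_sumr.
  by apply: eq_bigr => i _; rewrite mulrC.
have := max_dens y0 yS; rewrite ys dens_add_point // -/c -[tri _ _ _ _]/(link x u) -/L.
move=> /(_ ltac:(lra)) h.
have h2 : 3 * L <= 3 * c + 3 * c * k + c * k ^+ 2.
  rewrite -(ler_pM2l k0); lra.
have : c * k ^+ 2 <= c * k by apply: ler_wpM2l => //; rewrite expr2; nra.
nra.
Qed.

(** Complementary slackness: the terms [x i * (dens x - link x i)] are nonnegative by [max_link_le]
    and sum to zero. *)
Lemma max_link u : x u * link x u = dens x * x u.
Proof.
have [x0 xS x1] := wx.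
have h i : 0 <= x i * (dens x - link x i).
  have [iS|/xS ->] := boolP (i \in S); last by rewrite mul0r.
  by rewrite mulr_ge0 // subr_ge0 max_link_le.
have : \sum_i x i * (dens x - link x i) = 0.
  under eq_bigr do rewrite mulrBr.
  by rewrite sumrB sum_link -mulr_suml x1 mul1r subrr.
move=> /eqP; rewrite psumr_eq0 // => /allP /(_ u (mem_index_enum _)) /= /eqP.
by rewrite mulrBr mulrC => /subr0_eq ->.
Qed.
End Max.

Lemma codeg_ge0 x u v : (forall i, 0 <= x i) -> 0 <= codeg x u v.
Proof. by move=> x0; apply: sumr_ge0 => i _; rewrite mulr_ge0 // ler0n. Qed.

Lemma codeg_diag x u : codeg x u u = 0.
Proof. by apply: big1 => i _; rewrite e_irr mulr0. Qed.

Lemma codeg_le x u v : (forall i, 0 <= x i) -> \sum_i x i = 1 -> u != v ->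
  codeg x u v <= 1 - x u - x v.
Proof.
move=> x0 x1 uv.
have split2 (F : T -> R) : \sum_i F i = F u + F v + \sum_(i | (i != u) && (i != v)) F i.
  by rewrite (bigD1 u) //= (bigD1 v) 1?eq_sym //= addrA.
rewrite /codeg -[X in _ <= X - _ - _]x1 !split2.
have -> : e u v u = false by rewrite e23 e_irr.
have -> : e u v v = false by rewrite e12 e23 e_irr.
have : \sum_(i | (i != u) && (i != v)) x i * (e u v i)%:R <= \sum_(i | (i != u) && (i != v)) x i.
  by apply: ler_sum => i _; rewrite ler_piMr // lern1; case: (e u v i).
by rewrite !mulr0 addr0 add0r; lra.
Qed.

Lemma max_witness x S : weight S x -> exists2 u, u \in S &
  (forall i, x i <= x u) /\ 1 <= #|S|%:R * x u.
Proof.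
move=> wx; have [x0 xS x1] := wx; have [w wS] := weight_neq0 wx.
case: (@Order.TotalTheory.arg_maxP _ _ _ w (mem S) x wS) => u uS umax.
have hmax i : x i <= x u by have [/umax //|/xS ->] := boolP (i \in S).
exists u => //; split=> //.
rewrite -[leLHS]x1 (bigID (mem S)) /= [X in _ + X]big1 ?addr0 => [|i /xS //].
by rewrite mulr_natl -sumr_const; apply: ler_sum => i _.
Qed.

(* [6] times the Lagrangian of the complete 3-graph on [k] vertices. *)
Definition clique_dens (k : R) := (1 - k^-1) * (1 - 2 * k^-1).

Lemma sum_but u (g : T -> R) : \sum_(v | v != u) g v = \sum_v g v - g u.
Proof. by rewrite [in RHS](bigD1 u) //= addrAC subrr add0r. Qed.

(** Sum [codeg_le] over [v != u] with weights [x v]. *)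
Lemma max_link_codeg x u : (forall i, 0 <= x i) -> \sum_i x i = 1 ->
  link x u + sqsum x - x u ^+ 2 <= (1 - x u) ^+ 2.
Proof.
move=> x0 x1; rewrite link_codeg (bigD1 u) //= codeg_diag mulr0 add0r -addrA.
rewrite -sum_but -big_split /=.
apply: (@le_trans _ _ (\sum_(v | v != u) x v * (1 - x u))).
  apply: ler_sum => v vu; rewrite expr2 -mulrDr ler_wpM2l //.
  by have := @codeg_le x u v x0 x1; rewrite eq_sym => /(_ vu); lra.
by rewrite -mulr_suml sum_but // x1 expr2.
Qed.


(** At an optimum the link of the heaviest vertex has weight [dens y]. [max_link_codeg] and
    Cauchy-Schwarz on the other [n - 1] vertices give [h1], and the heaviest weight [M] is at least
    [1 / n]. For [n = 1] the division by [n - 1] fails, but both sides vanish. *)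
Lemma dens_card S x : weight S x -> dens x <= clique_dens #|S|%:R.
Proof.
move=> wx'; have [w wS] := weight_neq0 wx'.
have SN0 : S != set0%SET by apply/set0Pn; exists w.
have [y wy ymax] := @max_weight R T e S SN0.
apply: le_trans (ymax _ wx') _ => {x wx'}.
have [y0 yS y1] := wy; have [u uS [umax un]] := max_witness wy.
set n : R := #|S|%:R in un *; set M := y u in un.
have n0 : 0 < n by rewrite ltr0n card_gt0.
have M0 : 0 < M by rewrite -(pmulr_rgt0 _ n0); lra.
have M1 : M <= 1 by rewrite -y1 (bigD1 u) //= lerDl sumr_ge0.
have LE : link y u = dens y.
  by apply: (mulfI (lt0r_neq0 M0)); rewrite (max_link wy ymax) mulrC.
have := max_link_codeg u y0 y1; rewrite LE -/M => h.
have c1 : (1 - M) ^+ 2 <= (n - 1) * (sqsum y - M ^+ 2).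
  have := cauchy_sum (S :\ u) y.
  have -> : #|S :\ u|%:R = n - 1 :> R by rewrite /n (cardsD1 u S) uS natrD addrAC subrr add0r.
  have E (F : T -> R) : (forall i, y i = 0 -> F i = 0) ->
      \sum_(i in S :\ u) F i = \sum_i F i - F u.
    move=> F0; rewrite -(sum_support wy F0) [in RHS](bigD1 u) //= addrAC subrr add0r.
    by apply: eq_bigl => i; rewrite !inE andbC.
  by rewrite !E ?y1 // => i ->; rewrite expr0n.
have n1 : 1 <= n by rewrite ler1n card_gt0.
have [n1'|n1'] := eqVneq n 1.
  have M1' : M = 1 by move: un; rewrite n1'; lra.
  rewrite /clique_dens n1' invr1 subrr mul0r; move: h; rewrite M1'.
  have : M ^+ 2 <= sqsum y by rewrite /sqsum (bigD1 u) //= lerDl sumr_ge0 // => i _; apply: sqr_ge0.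
  by rewrite M1'; lra.
have n2 : 2 <= n.
  have S1 : #|S| != 1%N by apply: contraNneq n1' => S1; rewrite /n S1.
  by rewrite /n ler_nat ltn_neqAle eq_sym S1 card_gt0.
have Mn : n^-1 <= M by rewrite -ler_pdivrMl // in un; move: un; rewrite mulr1.
have h1 : (n - 1) * dens y <= (n - 2) * (1 - M) ^+ 2.
  have : (n - 1) * (dens y + sqsum y - M ^+ 2) <= (n - 1) * (1 - M) ^+ 2.
    by apply: ler_wpM2l => //; lra.
  by lra.
have h2 : (n - 2) * (1 - M) ^+ 2 <= (n - 2) * (1 - n^-1) ^+ 2.
  apply: ler_wpM2l; first by lra.
  by rewrite ler_sqr ?nnegrE ?subr_ge0 //; lra.
rewrite -(@ler_pM2l _ (n - 1)); last by lra.
apply: le_trans h1 (le_trans h2 _).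
rewrite /clique_dens -subr_ge0.
rewrite (_ : _ - _ = 0) //; field; exact: lt0r_neq0.
Qed.

(** [0 < a] matters because [0^-1 = 0] makes [clique_dens 0] equal to [1]. The case [a = 1] is
    separate: [clique_dens] vanishes at [1] and [2] but is negative in between. *)
Lemma clique_dens_le (a b : nat) : (0 < a)%N -> (a <= b)%N ->
  clique_dens a%:R <= clique_dens b%:R.
Proof.
move=> a0 ab; rewrite /clique_dens.
have b0 : (0 < b)%N by apply: leq_trans ab.
have ia : 0 < (a%:R : R)^-1 by rewrite invr_gt0 ltr0n.
have ib : 0 < (b%:R : R)^-1 by rewrite invr_gt0 ltr0n.
have iab : (b%:R : R)^-1 <= a%:R^-1 by rewrite lef_pV2 ?posrE ?ltr0n // ler_nat.
have [a1|a1] := leqP a 1.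
  have -> : a = 1%N by apply/eqP; rewrite eqn_leq a1.
  rewrite invr1 subrr mul0r; case: b b0 {ab ib iab} => [//|[|b]] _; first by rewrite invr1 subrr mul0r.
  have h : 2 * (b.+2%:R : R)^-1 <= 1 by rewrite ler_pdivrMr ?mul1r ?ler_nat // ltr0n.
  have h0 : 0 < (b.+2%:R : R)^-1 by rewrite invr_gt0 ltr0n.
  by move: (_^-1) h h0 => i h h0; apply: mulr_ge0; lra.
have h : 2 * (a%:R : R)^-1 <= 1 by rewrite ler_pdivrMr ?mul1r ?ler_nat // ltr0n.
move: (a%:R^-1) (b%:R^-1) ia ib iab h => i j i0 j0 ji h.
have : 0 <= (i - j) * (3 - 2 * (i + j)) by apply: mulr_ge0; lra.
lra.
Qed.

Definition dense (k : nat) S := exists2 x : T -> R, weight S x & clique_dens k%:R < dens x.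

(* Optimality makes the removal of [w] scale the density by exactly [leaf (x w)], and the
   lightest vertex weighs less than [1 / k] since more than [k] vertices are present. *)
Lemma dense_del (k : nat) S : (3 <= k)%N -> dense k S ->
  exists2 w, w \in S & dense k.-1 (S :\ w).
Proof.
move=> k3 [x' wx' dx']; have [w' w'S] := weight_neq0 wx'.
have SN0 : S != set0%SET by apply/set0Pn; exists w'.
have [x wx xmax] := @max_weight R T e S SN0.
have {wx' dx' x'} dx : clique_dens k%:R < dens x := lt_le_trans dx' (xmax _ wx').
have [x0 xS x1] := wx.
have Sk : (k < #|S|)%N.
  rewrite ltnNge; apply/negP => Sk.
  have := le_trans (dens_card wx) (clique_dens_le _ Sk).
  by rewrite card_gt0 => /(_ SN0); rewrite leNgt dx.
case: (@Order.TotalTheory.arg_minP _ _ _ w' (mem S) x w'S) => w wS wmin.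
set b : R := k%:R^-1.
have b0 : 0 < b by rewrite invr_gt0 ltr0n; apply: leq_trans k3.
have b3 : 3 * b <= 1 by rewrite ler_pdivrMr ?mul1r ?ler_nat // ltr0n; apply: leq_trans k3.
have xb : x w < b.
  rewrite -(@ltr_pM2l _ k%:R) ?ltr0n; last by apply: leq_trans k3.
  rewrite mulfV ?pnatr_eq0 -?lt0n; last by apply: leq_trans k3.
  have [xw0|xw0] := eqVneq (x w) 0; first by rewrite xw0 mulr0.
  have xwp : 0 < x w by rewrite lt_neqAle eq_sym xw0 x0.
  apply: (@lt_le_trans _ _ (#|S|%:R * x w)); first by rewrite ltr_pM2r // ltr_nat.
  rewrite -[leRHS]x1 -(sum_support wx) // mulr_natl -sumr_const.
  by apply: ler_sum => i iS; apply: wmin.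
exists w => //.
have del0 i : 0 <= del x w i by rewrite delE; case: eqP.
have delS i : i \notin S :\ w -> del x w i = 0.
  by rewrite delE !inE negb_and negbK; case: eqP => //= _ /xS.
have dels : \sum_i del x w i = 1 - x w by rewrite sum_del x1.
have s0 : 0 < \sum_i del x w i by rewrite dels; lra.
exists ((\sum_i del x w i)^-1 \*o del x w); first exact: normalize.
rewrite densZ // exprVn mulrC dels ltr_pdivlMr ?exprn_gt0 //; last by lra.
rewrite dens_del // -[tri _ _ _ _]/(link x w) (max_link wx xmax).
have -> : dens x - 3 * (dens x * x w) = dens x * (1 - 3 * x w) by ring.
have k1 : k.-1%:R = k%:R - 1 :> R by rewrite -subn1 natrB //; apply: leq_trans k3.
have kb : k%:R = b^-1 :> R by rewrite /b invrK.
have bN : b != 0 by rewrite gt_eqF.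
have b1 : 1 - b != 0 by apply: lt0r_neq0; lra.
(* This value is [clique_dens k * leaf b]: one of [k] equal weights is deleted. *)
have -> : clique_dens k.-1%:R = (1 - 2 * b) * (1 - 3 * b) / (1 - b) ^+ 2.
  rewrite /clique_dens k1 kb (_ : b^-1 - 1 = (1 - b) / b); last by field.
  by rewrite invf_div; field.
have xw0 := x0 w.
have hc : (1 - b) * (1 - 2 * b) * (1 - 3 * x w) < dens x * (1 - 3 * x w).
  by rewrite ltr_pM2r //; lra.
apply: le_lt_trans hc.
rewrite mulrAC ler_pdivrMr ?exprn_gt0 //; last by lra.
have -> : (1 - b) * (1 - 2 * b) * (1 - 3 * x w) * (1 - b) ^+ 2 =
  (1 - 2 * b) * ((1 - 3 * x w) * (1 - b) ^+ 3) by ring.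
rewrite -mulrA; apply: ler_wpM2l; first by lra.
(* For [k = 3] the target is [clique_dens 2 = 0], and [leaf_le] does not apply at [b]. *)
have [b3'|b3'] := eqVneq (3 * b) 1.
  by rewrite b3' subrr mul0r mulr_ge0 ?exprn_ge0 //; lra.
have /leaf_le : x w <= b by apply: ltW.
move=> /(_ xw0); rewrite lt_neqAle b3' b3 => /(_ isT).
rewrite /leaf ler_pdivrMr ?exprn_gt0 //; last by lra.
by rewrite mulrAC ler_pdivlMr ?exprn_gt0 //; lra.
Qed.

Lemma dense_dels (j k : nat) S : (2 <= k)%N -> dense (k + j) S ->
  exists S' : {set T}, [/\ S' \subset S, (#|S'| + j = #|S|)%N & dense k S'].
Proof.
move=> k2; elim: j S => [|j IH] S; first by rewrite addn0 => ?; exists S; rewrite addn0.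
rewrite addnS => /dense_del; case=> [|w wS /= /IH[S' [sub cS dS']]].
  by rewrite ltnS; apply: leq_trans k2 (leq_addr j k).
exists S'; split=> //; first by apply: subset_trans sub (subD1set _ _).
by rewrite (cardsD1 w S) wS -cS addnS.
Qed.

(* The bound on the sum of squares is propagated because removing any single vertex and
   renormalising turns [Q = sqsum y] into at most [Q / (1 - Q)]. *)
Definition heavy (C z : R) S :=
  exists y : T -> R, [/\ weight S y, C <= dens y & sqsum y <= z].

Lemma heavy_del C z S : 0 < C -> 3 * z < 1 -> heavy C z S ->
  exists2 w, w \in S & heavy (C * leaf z) (z / (1 - z)) (S :\ w).
Proof.
move=> C0 z3 [y [wy Cy Qz]]; have [y0 yS y1] := wy.
have d0 : 0 < dens y by apply: lt_le_trans Cy.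
have [w wS dw] := exists_leaf e12 e23 e_irr wy d0 Qz z3.
have yw2 : y w ^+ 2 <= sqsum y.
  by rewrite /sqsum (bigD1 w) //= lerDl sumr_ge0 // => i _; apply: sqr_ge0.
have yw1 : y w < 1 by have := y0 w; nra.
exists w => //.
have del0 i : 0 <= del y w i by rewrite delE; case: eqP.
have delS i : i \notin S :\ w -> del y w i = 0.
  by rewrite delE !inE negb_and negbK; case: eqP => //= _ /yS.
have dels : \sum_i del y w i = 1 - y w by rewrite sum_del y1.
have s0 : 0 < \sum_i del y w i by rewrite dels; lra.
exists ((\sum_i del y w i)^-1 \*o del y w); split; first exact: normalize.
  rewrite densZ // exprVn [leRHS]mulrC dels ler_pdivlMr ?exprn_gt0 //; last by lra.
  apply: le_trans dw; apply: ler_wpM2r; first by rewrite exprn_ge0 //; lra.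
  by apply: ler_wpM2r => //; apply/ltW/leaf_gt0.
have -> : sqsum ((\sum_i del y w i)^-1 \*o del y w) = (sqsum y - y w ^+ 2) / (1 - y w) ^+ 2.
  rewrite dels /sqsum /= [in RHS](bigD1 w) //= addrAC subrr add0r mulrC mulr_sumr.
  rewrite (bigD1 w) //= delE eqxx mulr0 expr0n add0r.
  by apply: eq_bigr => i /negPf iw; rewrite delE iw exprMn exprVn.
set Q := sqsum y in Qz yw2 *.
have Q0 : 0 <= Q by apply: le_trans yw2; apply: sqr_ge0.
(* After cross-multiplication the two sides differ by [(y w - Q) ^+ 2], so the bound holds whichever
   [w] is deleted. *)
apply: (@le_trans _ _ (Q / (1 - Q))).
  rewrite ler_pdivrMr ?exprn_gt0 ?subr_gt0 // mulrAC ler_pdivlMr; last by lra.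
  have : 0 <= (y w - Q) ^+ 2 by apply: sqr_ge0.
  by lra.
rewrite ler_pdivrMr; last by lra.
by rewrite mulrAC ler_pdivlMr; lra.
Qed.

End Optimal.

(** * The common neighbourhood of a pair *)

Section Neighbourhood.
Variables (R : realType) (T : finType) (e : T -> T -> T -> bool).
Hypotheses (e12 : forall a b c, e a b c = e b a c)
  (e23 : forall a b c, e a b c = e a c b) (e_irr : forall a c, e a a c = false).
Implicit Types (x y f g : T -> R) (u v w : T) (S : {set T}).
Local Notation dens := (dens e).
Local Notation codeg := (codeg e).
Local Notation link := (link e).

(** For each first vertex, only pairs of distinct vertices contribute; the diagonal they miss has
    weight [sqsum g]. *)
Lemma tri_le f g : (forall i, 0 <= f i) -> (forall i, 0 <= g i) ->
  tri e f g g <= (\sum_i f i) * ((\sum_i g i) ^+ 2 - sqsum g).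
Proof.
move=> f0 g0; rewrite tri_sum mulr_suml; apply: ler_sum => a _.
apply: ler_wpM2l => //; rewrite tri_point expr2 mulr_suml /sqsum -sumrB.
apply: ler_sum => v _; rewrite expr2 -mulrBr; apply: ler_wpM2l => //.
rewrite -sum_but /codeg (bigD1 v) //= (_ : e a v v = false); last by rewrite e12 e23 e_irr.
rewrite mulr0 add0r; apply: ler_sum => i _.
by rewrite ler_piMr // lern1; case: (e a v i).
Qed.

(* Split [x] into its parts [xs] inside and [xp] outside [r]: the identities [h1] and [h2],
   the latter being the optimality of [x], eliminate [tri e xp xp xs]. *)
Lemma dens_restrict S x (r : pred T) (xs := fun i => x i * (r i)%:R) (eta := \sum_i xs i) :
  weight S x -> (forall y, weight S y -> dens y <= dens x) ->
  dens x * (1 - 3 / 2 * (1 - eta)) - 3 / 2 * (1 - eta) * (eta ^+ 2 - sqsum xs) <= dens xs.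
Proof.
move=> wx xmax; have [x0 xS x1] := wx.
pose xp i := x i * (~~ r i)%:R.
have xs0 i : 0 <= xs i by rewrite mulr_ge0.
have xp0 i : 0 <= xp i by rewrite mulr_ge0.
have xE : x =1 xs \+ xp by move=> i; rewrite /= /xs /xp; case: (r i); rewrite /= ?mulr1 ?mulr0 ?addr0 ?add0r.
have xpE : \sum_i xp i = 1 - eta.
  by rewrite -x1 (eq_bigr _ (fun i _ => xE i)) big_split /= addrAC subrr add0r.
have h1 : dens x = dens xs + 3 * tri e xp xs xs + 3 * tri e xp xp xs + dens xp.
  by rewrite -densD // /dens; apply: eq_tri.
have h2 : dens x * (1 - eta) = tri e xp xs xs + 2 * tri e xp xp xs + dens xp.
  transitivity (tri e xp x x).
    rewrite tri_sum -xpE mulr_sumr; apply: eq_bigr => i _.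
    by rewrite /xp mulrA -(max_link e12 e23 e_irr wx xmax) mulrAC.
  rewrite (eq_tri e (f:=xp) (f':=xp) (g':=xs \+ xp) (h':=xs \+ xp)) //.
  by rewrite !(triDm, triDr) // (tri23 e23 xp xs xp) /dens; ring.
have h3 := tri_le xp0 xs0; rewrite xpE -/eta in h3.
have h4 : 0 <= dens xp by apply: dens_ge0.
(* Subtracting [3 / 2] times [h2] from [h1] cancels [tri e xp xp xs]; [h3] bounds [tri e xp xs xs],
   and [dens xp] remains with the favourable coefficient [1 / 2]. *)
lra.
Qed.

(** Otherwise a vanishing sum of nonnegative terms forces [x v = 0] for every [v != u], against
    [x u < 1]. *)
Lemma exists_above_mean x u g : (forall i, 0 <= x i) -> \sum_i x i = 1 -> x u < 1 ->
  exists2 v, v != u & \sum_(v | v != u) x v * g v <= (1 - x u) * g v.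
Proof.
move=> x0 x1 xu1; set K := \sum_(v | v != u) x v * g v.
case: (pickP [pred v | (v != u) && (K <= (1 - x u) * g v)]) => [v /andP[]|H]; first by exists v.
exfalso.
have Hlt v : v != u -> (1 - x u) * g v < K.
  by move=> vu; have := H v; rewrite /= vu /= => /negbT; rewrite -ltNge.
have h0 v : v != u -> 0 <= x v * (K - (1 - x u) * g v).
  by move=> /Hlt h; rewrite mulr_ge0 // subr_ge0 ltW.
have : \sum_(v | v != u) x v * (K - (1 - x u) * g v) = 0.
  under eq_bigr => v _ do rewrite mulrBr mulrCA.
  by rewrite sumrB -mulr_suml -mulr_sumr -/K sum_but x1 subrr.
move/eqP; rewrite psumr_eq0 // => /allP hz.
have : \sum_(v | v != u) x v = 0.
  apply: big1 => v vu; have := hz v (mem_index_enum _); rewrite vu /= mulf_eq0.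
  by rewrite subr_eq0 (gt_eqF (Hlt v vu)) orbF => /eqP.
rewrite sum_but x1; lra.
Qed.

Definition nbrs u v := [set w | e u v w].

Lemma link_sum x u : link x u = \sum_(v | v != u) x v * codeg x u v.
Proof. by rewrite link_codeg (bigD1 u) //= codeg_diag // mulr0 add0r. Qed.

(* [u] is a heaviest vertex.  If its weight is at most [1 / m], then [v] is chosen
   to maximise the codegree; otherwise [v] minimises the weight of the vertices
   [w] outside [u, v] for which [u, v, w] is not an edge. *)
Lemma heavy_nbrs (m : nat) (y : T -> R) : (7 <= m)%N -> weight [set: T] y ->
  clique_dens m%:R < dens y ->
  exists (u v : T) (C z : R), [/\ heavy e C z (nbrs u v), 0 <= z, 5 * z < 1 &
    clique_dens (m - 5)%:R < C * leaf z * leaf (z / (1 - z)) * leaf (z / (1 - 2 * z))].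
Proof.
move=> m7 wx' dx'; have [w0 w0S] := weight_neq0 wx'.
have SN0 : [set: T]%SET != set0%SET by apply/set0Pn; exists w0.
have [x wx xmax] := @max_weight R T e [set: T]%SET SN0.
have {wx' dx' y} dx : clique_dens m%:R < dens x := lt_le_trans dx' (xmax _ wx').
have [x0 _ x1] := wx; set c := dens x in dx.
have [u _ [umax un]] := max_witness wx; set M := x u in umax un.
have M0 : 0 < M by rewrite -(@pmulr_rgt0 _ #|[set: T]|%:R) ?ltr0n ?card_gt0 //; lra.
have LE : link x u = c by apply: (mulfI (lt0r_neq0 M0)); rewrite /M (max_link e12 e23 e_irr wx xmax) mulrC.
set A : R := m%:R - 2.
have m7R : 7 <= m%:R :> R by rewrite ler_nat.
have A5 : 5 <= A by rewrite /A; lra.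
set b := (A + 2)^-1.
have bE : b = m%:R^-1 by rewrite /b /A subrK.
have b0 : 0 < b by rewrite invr_gt0; lra.
have b7 : b * 7 <= 1 by rewrite mulrC ler_pdivrMr; lra.
have hc : (1 - b) * (1 - 2 * b) < c by rewrite bE.
have cM := max_link_codeg e12 e23 e_irr u x0 x1; rewrite LE -/M in cM.
have QM : M ^+ 2 <= sqsum x by rewrite /sqsum (bigD1 u) //= lerDl sumr_ge0 // => i _; apply: sqr_ge0.
have M1 : M < 1.
  rewrite lt_neqAle -[X in _ && (_ <= X)]x1 [X in _ && (_ <= X)](bigD1 u) //= lerDl sumr_ge0 // andbT.
  by apply/negP => /eqP M1; rewrite M1 in cM QM; nra.
suff [v [vu eta0 [h1 h2]]] : exists v, [/\ v != u, 0 < codeg x u v &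
    let q := \sum_i (x i * (e u v i)%:R) ^+ 2 in let eta := codeg x u v in
    q * (1 - 2 * b) < b * eta ^+ 2 /\ q <= eta ^+ 2 - (1 - 3 * b) * eta].
  pose xs i := x i * (e u v i)%:R; set q := \sum_i (x i * _) ^+ 2 in h1 h2.
  set eta := codeg x u v in h1 h2 eta0.
  have eta1 : eta <= 1.
    have := @codeg_le R T e e12 e23 e_irr x u v x0 x1; rewrite eq_sym => /(_ vu).
    by have := x0 v; rewrite -/M -/eta; lra.
  have q0 : 0 <= q by apply: sumr_ge0 => i _; apply: sqr_ge0.
  have e0 := dens_restrict (e u v) wx xmax; rewrite /= -/(codeg x u v) -/eta -/c in e0.
  have etaP : 0 < eta <= 1 by rewrite eta0.
  have := three_leaves A5 hc etaP q0 h1 h2 e0.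
  set z := q / eta ^+ 2 => -[z0 z5 hC].
  exists u, v, (dens xs / eta ^+ 3), z; split=> //; last first.
    rewrite natrB; last by apply: leq_trans m7.
    have A3 : A - 3 != 0 by apply: lt0r_neq0; lra.
    apply: le_lt_trans hC; rewrite /clique_dens (_ : m%:R - 5%:R = A - 3); last by rewrite /A; ring.
    rewrite le_eqVlt; apply/orP; left; apply/eqP.
    by move: (A) A3 => A' A3; field.
  have xs0 i : 0 <= xs i by rewrite mulr_ge0.
  have xsS i : i \notin nbrs u v -> xs i = 0.
    by rewrite inE /xs => /negPf ->; rewrite mulr0.
  exists ((\sum_i xs i)^-1 \*o xs); split; first exact: normalize.
    by rewrite densZ // -[\sum_i xs i]/eta exprVn mulrC.
  rewrite -[\sum_i xs i]/eta /sqsum /z /q mulrC mulr_sumr.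
  by apply: ler_sum => i _; rewrite /= exprMn exprVn.
have qle v : v != u -> \sum_i (x i * (e u v i)%:R) ^+ 2 <= sqsum x - M ^+ 2 - x v ^+ 2.
  move=> vu; rewrite /sqsum.
  have split2 (F : T -> R) : \sum_i F i = F u + F v + \sum_(i | (i != u) && (i != v)) F i.
    by rewrite (bigD1 u) //= (bigD1 v) //= addrA.
  rewrite !split2 -/M.
  have -> : e u v u = false by rewrite e23 e_irr.
  have -> : e u v v = false by rewrite e12 e23 e_irr.
  rewrite !mulr0 expr0n /= !add0r.
  have : \sum_(i | (i != u) && (i != v)) (x i * (e u v i)%:R) ^+ 2 <= \sum_(i | (i != u) && (i != v)) x i ^+ 2.
    apply: ler_sum => i _; rewrite exprMn ler_piMr ?sqr_ge0 //.
    by case: (e u v i); rewrite ?expr1n ?expr0n.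
  by lra.
have cpos : 0 < c by nra.
have [Mb|Mb] := leP M b.
  have [v vu hv] := @exists_above_mean x u (codeg x u) x0 x1 M1.
  rewrite -link_sum LE -/M in hv.
  have eta0 : 0 < codeg x u v.
    have h : 0 < (1 - M) * codeg x u v by lra.
    by rewrite pmulr_rgt0 in h; lra.
  exists v; split=> //=; apply: (@region_light R b c M) => //; first by rewrite ltW.
  rewrite /codeg mulr_sumr; apply: ler_sum => i _.
  rewrite expr2; apply: ler_wpM2r; first by rewrite mulr_ge0.
  by case: (e u v i); rewrite ?mulr1 ?mulr0 //; apply: ltW.
(* Averaging the codegree plus [x v] brings the sum of squares into the inequality, and [qle] then
   uses it to control [q]. *)
have [v vu hv] := @exists_above_mean x u (fun v => codeg x u v + x v) x0 x1 M1.
have {hv} hv : c + (sqsum x - M ^+ 2) <= (1 - M) * (codeg x u v + x v).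
  apply: le_trans hv; under eq_bigr do rewrite mulrDr -expr2.
  by rewrite big_split /= -link_sum LE sum_but.
have ey : codeg x u v + x v <= 1 - M.
  by have := @codeg_le R T e e12 e23 e_irr x u v x0 x1; rewrite eq_sym => /(_ vu); rewrite -/M; lra.
have q0 : 0 <= \sum_i (x i * (e u v i)%:R) ^+ 2 by apply: sumr_ge0 => i _; apply: sqr_ge0.
have qv := qle v vu.
have y0 := x0 v; have yM := umax v.
(* A zero codegree would give [c <= (1 - M) ^+ 2 / 4], too small for [hc]. *)
have eta0 : 0 < codeg x u v.
  rewrite lt_neqAle codeg_ge0 // andbT eq_sym; apply/negP => /eqP eta0.
  rewrite eta0 add0r in hv ey.
  have : x v * (1 - M - x v) <= (1 - M) ^+ 2 / 4 by have := sqr_ge0 (1 - M - 2 * x v); lra.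
  by nra.
exists v; split=> //=.
apply: (@region_heavy R b c M _ _ (x v) (sqsum x - M ^+ 2)) => //; last by lra.
by rewrite ltW.
Qed.

(* This is where [3 <= t] is needed: three leaves compensate for removing every
   vertex outside the common neighbourhood of [u, v]. *)
Lemma dense_nbrs (m : nat) : (7 <= m)%N -> @dense R T e m [set: T] ->
  exists u v S', [/\ S' \subset nbrs u v, (#|S'| + 3 = #|nbrs u v|)%N & @dense R T e (m - 5) S'].
Proof.
move=> m7 [x wx dx]; have [u [v [C [z [hS z0 z5 hC]]]]] := heavy_nbrs m7 wx dx.
have z1 : z / (1 - z) / (1 - z / (1 - z)) = z / (1 - 2 * z).
  by field; rewrite -?andbA; do ?[apply/andP; split]; rewrite gt_eqF //; lra.
have l1 : 3 * z < 1 by lra.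
have l2 : 3 * (z / (1 - z)) < 1 by rewrite mulrA ltr_pdivrMr; lra.
have l3 : 3 * (z / (1 - 2 * z)) < 1 by rewrite mulrA ltr_pdivrMr; lra.
have L1 := leaf_gt0 l1; have L2 := leaf_gt0 l2; have L3 := leaf_gt0 l3.
have cd0 : 0 <= clique_dens (m - 5)%:R :> R.
  have : (1 <= m - 5)%N by rewrite subn_gt0; apply: leq_trans m7.
  move=> /(@clique_dens_le R 1 (m - 5) isT); apply: le_trans.
  by rewrite /clique_dens invr1 subrr mul0r.
have C0 : 0 < C.
  have := le_lt_trans cd0 hC.
  by rewrite (pmulr_lgt0 _ L3) (pmulr_lgt0 _ L2) (pmulr_lgt0 _ L1).
have [w1 w1S h1] := heavy_del e12 e23 e_irr C0 l1 hS.
have [w2 w2S h2] := heavy_del e12 e23 e_irr (mulr_gt0 C0 L1) l2 h1.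
rewrite z1 in h2.
have [w3 w3S [y [wy Cy _]]] := heavy_del e12 e23 e_irr (mulr_gt0 (mulr_gt0 C0 L1) L2) l3 h2.
exists u, v, (nbrs u v :\ w1 :\ w2 :\ w3); split.
- by rewrite !(subset_trans (subD1set _ _)) // subD1set.
- rewrite (cardsD1 w1 (nbrs u v)) w1S (cardsD1 w2 (nbrs u v :\ w1)) w2S.
  by rewrite (cardsD1 w3 (nbrs u v :\ w1 :\ w2)) w3S addnC.
- by exists y => //; apply: lt_le_trans Cy.
Qed.

(** [dense_nbrs] provides three leaves and [dense_dels] the other [t - 3], since
    [s + t + 1 - 5 = (s - 1) + (t - 3)]. *)
Lemma dense_star_disjoint (s t : nat) : (3 <= s)%N -> (3 <= t)%N ->
  @dense R T e (s + t + 1) [set: T] ->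
  exists u v S', [/\ S' \subset nbrs u v, (#|S'| + t = #|nbrs u v|)%N & @dense R T e s.-1 S'].
Proof.
move=> s3 t3 /dense_nbrs; case=> [|u [v [S [sS cS dS]]]].
  by rewrite addn1 ltnS (leq_trans _ (leq_add s3 t3)).
have E : (s + t + 1 - 5 = s.-1 + (t - 3))%N.
  by move: s3 t3; clear; lia.
have s2 : (2 <= s.-1)%N by move: s3; clear; lia.
rewrite E in dS; have [S' [sS' cS' dS']] := dense_dels e12 e23 e_irr s2 dS.
exists u, v, S'; split=> //; first exact: subset_trans sS.
by rewrite -cS -cS' -addnA subnK.
Qed.
End Neighbourhood.

(** * Hypergraphs *)

Section Adjacency.
Variable G : hypergraph 3.

Definition adj (a b c : G) := [set a; b; c] \in edges G.

Lemma adj12 a b c : adj a b c = adj b a c.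
Proof. by rewrite /adj (setUC [set a]). Qed.

Lemma adj23 a b c : adj a b c = adj a c b.
Proof. by rewrite /adj setUAC. Qed.

Lemma adj_irr a c : adj a a c = false.
Proof.
by apply/negP => /edge_card; rewrite setUid cards2; case: eqP.
Qed.

Variable R : realType.
Implicit Types (x : G -> R) (S : {set G}).

(** In this form the sum over orderings of [E] becomes three nested sums with [3], [2] and [1]
    terms. *)
Lemma set3_eq (E : {set G}) a b c : #|E| = 3 ->
  ([set a; b; c] == E) = [&& a \in E, b \in E :\ a & c \in E :\ a :\ b].
Proof.
move=> E3.
have card3 : #|[set a; b; c]| = #|[:: a; b; c]|.
  by apply: eq_card => i; rewrite !inE orbA.
apply/eqP/and3P => [abcE|[aE]].
  have /card_uniqP /= : #|[:: a; b; c]| = size [:: a; b; c] by rewrite -card3 abcE.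
  rewrite !inE negb_or -abcE !inE !eqxx !orbT /= => /andP[/andP[ab ac] /andP[bc _]].
  by split; rewrite // ?(eq_sym b a) ?(eq_sym c a) ?(eq_sym c b) ?ab ?ac ?bc.
rewrite !inE => /andP[ba bE] /and3P[cb ca cE].
apply/eqP; rewrite eqEcard E3 card3 (card_uniqP _) /=.
  by rewrite andbT; apply/subsetP => i; rewrite !inE => /orP[/orP[]|] /eqP ->.
by rewrite !inE negb_or eq_sym ba eq_sym ca eq_sym cb.
Qed.

Lemma sum_ordered_triples x (E : {set G}) : #|E| = 3 ->
  \sum_a \sum_b \sum_(c | [set a; b; c] == E) x a * x b * x c = 6 * \prod_(i in E) x i.
Proof.
move=> E3; set P := \prod_(i in E) x i.
have card_del2 a b : a \in E -> b \in E :\ a -> #|E :\ a :\ b| = 1%N.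
  by move=> aE bE; move: E3; rewrite (cardsD1 a) aE (cardsD1 b) bE => -[].
transitivity (\sum_(a in E) \sum_(b in E :\ a) \sum_(c in E :\ a :\ b) P).
  rewrite [RHS]big_mkcond; apply: eq_bigr => a _.
  case: ifP => aE; last by apply: big1 => b _; apply: big1 => c; rewrite set3_eq // aE.
  rewrite [RHS]big_mkcond; apply: eq_bigr => b _.
  case: ifP => bE; last by apply: big1 => c; rewrite set3_eq // aE bE.
  apply: eq_big => c; first by rewrite set3_eq // aE bE.
  rewrite set3_eq // aE bE /= => cE.
  rewrite /P (big_setD1 a) //= (big_setD1 b) //= (big_setD1 c) //= -!mulrA.
  rewrite big1 ?mulr1 // => i; have /eqP := card_del2 _ _ aE bE.
  by rewrite (cardsD1 c) cE eqSS cards_eq0 => /eqP ->; rewrite inE.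
transitivity (\sum_(a in E) \sum_(b in E :\ a) P).
  by apply: eq_bigr => a aE; apply: eq_bigr => b bE; rewrite sumr_const card_del2.
transitivity (\sum_(a in E) P *+ 2).
  apply: eq_bigr => a aE; rewrite sumr_const; congr (_ *+ _).
  by move: E3; rewrite (cardsD1 a) aE => -[].
by rewrite sumr_const E3; ring.
Qed.

Lemma dens_lagr x : dens adj x = 6 * lagr x.
Proof.
rewrite /lagr mulr_sumr.
rewrite -(eq_bigr _ (fun E EG => sum_ordered_triples x (edge_card EG))).
symmetry; rewrite exchange_big; apply: eq_bigr => a _ /=.
rewrite exchange_big; apply: eq_bigr => b _ /=.
rewrite (exchange_big_dep xpredT) //=; apply: eq_bigr => c _ /=.
rewrite /adj; have [abc|abc] := boolP (_ \in _).
  rewrite mulr1 (big_pred1 [set a; b; c]) // => E; rewrite /= eq_sym.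
  by case: eqP => [->|_]; rewrite ?abc ?andbF.
rewrite mulr0 big_pred0 // => E; apply/negP => /andP[EG /eqP EE].
by move: abc; rewrite EE EG.
Qed.

Lemma simplexE x : simplex x <-> weight [set: G] x.
Proof. by split=> [[x0 x1]|[x0 _ x1]]; split=> // i; rewrite inE. Qed.

Lemma dens_le1 x : weight [set: G] x -> dens adj x <= 1.
Proof.
move=> wx; apply: le_trans (dens_card adj12 adj23 adj_irr wx) _.
set n := #|_|; have [->|n0] := posnP n; first by rewrite /clique_dens invr0 !(mulr0, subr0) mulr1.
rewrite /clique_dens; have : 0 < (n%:R : R)^-1 by rewrite invr_gt0 ltr0n.
have : (n%:R : R)^-1 <= 1 by rewrite invf_le1 ?ler1n ?ltr0n.
move: (_^-1) => i i1 i0; nra.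
Qed.

Lemma lagr_has_ubound : has_ubound [set lagr x | x in @simplex R G]%classic.
Proof.
exists (1 / 6) => _ [x /simplexE wx <-]; have := dens_le1 wx; rewrite dens_lagr; lra.
Qed.

Lemma lagrangian_ge x : weight [set: G] x -> dens adj x <= 6 * lagrangian R G.
Proof.
move=> wx; rewrite dens_lagr ler_pM2l //; apply: (ub_le_sup lagr_has_ubound).
by exists x => //; apply/simplexE.
Qed.

Lemma lagrangian_le1 : 6 * lagrangian R G <= 1.
Proof.
rewrite /lagrangian; set A := [set lagr x | x in _]%classic.
have [->|/set0P A0] := eqVneq A classical_sets.set0; first by rewrite sup0 mulr0.
suff : sup A <= 1 / 6 by lra.
apply: ge_sup => // _ [x /simplexE wx <-].
by have := dens_le1 wx; rewrite dens_lagr; lra.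
Qed.

(** A value strictly below a supremum is exceeded by some element. If the simplex is empty the
    supremum is [0], and [clique_dens k >= 0] excludes the left side. *)
Lemma denseP (k : nat) : (0 < k)%N ->
  (clique_dens k%:R < 6 * lagrangian R G <-> dense R adj k [set: G]).
Proof.
move=> k0; split=> [kG|[x wx dx]]; last exact: lt_le_trans (lagrangian_ge wx).
have k1 : 0 <= clique_dens k%:R :> R.
  by have := @clique_dens_le R 1 k isT k0; rewrite {1}/clique_dens invr1 subrr mul0r.
move: kG; rewrite /lagrangian; set A := [set lagr x | x in _]%classic.
have [->|/set0P A0] := eqVneq A classical_sets.set0; first by rewrite sup0 mulr0 ltNge k1.
rewrite -ltr_pdivrMl // => /(sup_gt A0)[_ [x /simplexE wx <-] h].
by exists x => //; rewrite dens_lagr; move: h; rewrite ltr_pdivrMl.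
Qed.

Lemma lagrangian_le_card : (0 < #|G|)%N -> 6 * lagrangian R G <= clique_dens #|G|%:R.
Proof.
move=> G0; rewrite leNgt; apply/negP => /(denseP G0) [x wx].
by rewrite ltNge (le_trans (dens_card adj12 adj23 adj_irr wx)) // cardsT.
Qed.
End Adjacency.

Section Induced.
Variables (G : hypergraph 3) (S : {set G}).

Definition induced_edges : {set {set {i | i \in S}}} :=
  [set E : {set {i | i \in S}} | val @: E \in edges G].

Lemma induced_card E : E \in induced_edges -> #|E| = 3.
Proof. by rewrite inE => /edge_card; rewrite card_imset //; apply: val_inj. Qed.

Definition induced : hypergraph 3 := Hypergraph induced_card.

Lemma adj_induced (a b c : induced) : adj a b c = adj (val a) (val b) (val c).
Proof. by rewrite /adj inE !imsetU !imset_set1. Qed.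

Lemma dense_induced (R : realType) k : dense R (@adj G) k S -> dense R (@adj induced) k [set: induced].
Proof.
move=> [x wx dx]; have [x0 xS x1] := wx; exists (x \o val).
  split=> [i|i|]; rewrite ?inE //=.
  by rewrite -(big_sub (mem S) x) -x1; apply: (sum_support wx).
rewrite (_ : dens _ _ = dens (@adj G) x) //.
have sub (F : G -> R) : (forall i, x i = 0 -> F i = 0) -> \sum_(i : induced) F (val i) = \sum_i F i.
  by move=> F0; rewrite -(sum_support wx F0) -(big_sub (mem S) F).
rewrite /dens /tri -sub => [|a a0]; last first.
  by apply: big1 => b _; apply: big1 => c _; rewrite a0 !mul0r.
apply: eq_bigr => a _; rewrite -sub => [|b b0]; last first.
  by apply: big1 => c _; rewrite b0 mulr0 !mul0r.
apply: eq_bigr => b _; rewrite -sub => [|c c0]; last by rewrite c0 mulr0 mul0r.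
by apply: eq_bigr => c _; rewrite adj_induced.
Qed.
End Induced.

(** Uniform weights: ['C(k, 3)] edges contribute [k ^- 3] each. *)
Lemma lagrangian_complete_ge (R : realType) (k : nat) : (0 < k)%N ->
  clique_dens k%:R <= 6 * lagrangian R (complete_hypergraph 3 k).
Proof.
move=> k0; pose x (i : complete_hypergraph 3 k) : R := k%:R^-1.
have kN : k%:R != 0 :> R by rewrite pnatr_eq0 -lt0n.
have wx : weight [set: complete_hypergraph 3 k] x.
  split=> [i|i|]; rewrite ?inE ?invr_ge0 ?ler0n //.
  by rewrite /x sumr_const card_ord -[_ *+ _]mulr_natr mulVf.
apply: le_trans (lagrangian_ge wx); rewrite dens_lagr /lagr.
rewrite (eq_bigr (fun=> k%:R ^- 3)) => [|E]; last first.
  by rewrite inE => /eqP E3; rewrite prodr_const E3 exprVn.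
rewrite sumr_const -[X in 6 * X]mulr_natr.
have -> : #|edges (complete_hypergraph 3 k)| = 'C(k, 3).
  by rewrite -[k in RHS]card_ord -card_draws.
have -> : 6 * (k%:R ^- 3 * 'C(k, 3)%:R) = (k * k.-1 * k.-2)%:R / k%:R ^+ 3 :> R.
  rewrite mulrCA -[6]/(6%:R) -natrM mulrC (_ : 6 = 3`!)%N // mulnC bin_ffact.
  by rewrite !ffactnSr ffactn0 mul1n subn0 subn1 subn2.
rewrite /clique_dens -subr_ge0; case: k k0 {x wx} kN => [//|[|[|k]]] _ kN.
- by rewrite invr1 subrr !mul0r subrr.
- by rewrite muln0 !mul0r sub0r oppr_ge0; lra.
rewrite (_ : _ - _ = 0) // !natrM /= -[k.+3]addn3 -addn2 -[k.+1]addn1 !natrD.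
by field; rewrite -[3]/(3%:R) -natrD pnatr_eq0 addn3.
Qed.

(* Embeds the star with centre [u, v] and leaves listed by [enum W], next to the given copy of [H]. *)
Lemma star_disjoint_contains (t : nat) (G H : hypergraph 3) (u v : G) (S : {set G}) :
  S \subset nbrs (@adj G) u v -> (#|S| + t = #|nbrs (@adj G) u v|)%N -> (0 < t)%N ->
  contains (induced S) H -> contains G (disjoint_union (S2 t) H).
Proof.
move=> SN cS t0 [f [f_inj f_edge]].
set N := nbrs _ u v in SN cS; set W := N :\: S.
have cW : #|W| = t by rewrite cardsD (setIidPr SN) -cS addKn.
have uN : u \notin N by rewrite inE adj23 adj_irr.
have vN : v \notin N by rewrite inE adj12 adj23 adj_irr.
have uv : u != v.
  have [w wN] : exists w, w \in N by apply/set0Pn; rewrite -card_gt0 -cS addn_gt0 t0 orbT.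
  by apply/eqP => uv; move: wN; rewrite inE uv adj_irr.
have uW : u \notin W by apply: contra uN => /setDP[].
have vW : v \notin W by apply: contra vN => /setDP[].
pose l := u :: v :: enum W.
have sl : size l = t.+2 by rewrite /= -cardE cW.
have l_uniq : uniq l.
  by rewrite /= inE negb_or uv !mem_enum uW vW enum_uniq.
have lS i : i \in S -> i \notin l.
  move=> iS; have iN := subsetP SN i iS.
  have iW : i \notin W by rewrite inE iS.
  rewrite !inE mem_enum (negPf iW) orbF negb_or; apply/andP.
  by split; apply: contraTneq iN => ->.
pose h (a : disjoint_union (S2 t) H) : G :=
  match a with inl i => nth u l (i : 'I_t.+2) | inr b => val (f b) end.
have il (i : 'I_t.+2) : (i < size l)%N by rewrite sl.
have h_inj : injective h.
  have lr (i : 'I_t.+2) b : nth u l i <> val (f b).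
    by move=> q; have := lS _ (valP (f b)); rewrite -q mem_nth ?il.
  move=> [i|a] [j|b] /= q.
  - congr inl; apply: val_inj; apply/eqP.
    by rewrite -(nth_uniq u (il i) (il j) l_uniq); apply/eqP.
  - by case: (lr i b).
  - by case: (lr j a).
  - by congr inr; apply: f_inj; apply: val_inj.
exists h; split=> // E /setUP[] /imsetP[E' E'_edge ->]; rewrite -imset_comp.
  move: E'_edge => /imsetP[j]; rewrite inE => j2 ->.
  rewrite !imsetU !imset_set1 /= !inordK //.
  rewrite -[X in X \in _]/[set u; v; nth u l j].
  have : nth u l j \in N.
    case: j j2 => [[|[|j]] //= jt] _.
    have : nth u (enum W) j \in enum W by rewrite mem_nth // -cardE cW.
    by rewrite mem_enum inE => /andP[].
  by rewrite inE.
have := f_edge _ E'_edge; rewrite inE -imset_comp.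
by rewrite (eq_imset (g := h \o inr)).
Qed.

Theorem theorem1p6 (R : realType) (s t : nat) (hs : (3 <= s)%N) (ht : (3 <= t)%N)
    (H : hypergraph 3) (cardH : #|H| = s) (perfH : perfect_hypergraph R H) :
  perfect_hypergraph R (disjoint_union (S2 t) H) /\
  lagrangian_density R (disjoint_union (S2 t) H)
    = 3`!%:R * lagrangian R (complete_hypergraph 3 (s + t + 1)%N).
Proof.
set F := disjoint_union (S2 t) H; set m := (s + t + 1)%N.
have cF : #|F| = m.+1.
  by rewrite card_sum card_ord cardH /m; lia.
suff main : lagrangian_density R F = 3`!%:R * lagrangian R (complete_hypergraph 3 m).
  by split=> //; rewrite /perfect_hypergraph cF.
have density_ub (K : hypergraph 3) : has_ubound [set y | exists2 G : hypergraph 3, hfree K G &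
    y = 3`!%:R * lagrangian R G]%classic.
  by exists 1 => _ [G _ ->]; apply: lagrangian_le1.
have m0 : (0 < m)%N by rewrite /m addn1.
(* The lower bound: [F] has [m + 1] vertices, too many for the complete graph on [m]. *)
have KF : hfree F (complete_hypergraph 3 m).
  by move=> [f [/leq_card f_inj _]]; move: f_inj; rewrite cF card_ord ltnn.
apply/eqP; rewrite eq_le; apply/andP; split; last first.
  by apply: (ub_le_sup (density_ub F)); exists (complete_hypergraph 3 m).
apply: ge_sup; first by exists (3`!%:R * lagrangian R (complete_hypergraph 3 m)), (complete_hypergraph 3 m).
move=> _ [G GF ->]; apply: le_trans (lagrangian_complete_ge R m0).
rewrite leNgt; apply/negP => /(@denseP G R m m0).
case/(dense_star_disjoint (@adj12 G) (@adj23 G) (@adj_irr G) hs ht) => u [v [S [SN cS dS]]].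
apply: GF; apply: (star_disjoint_contains SN cS); first by apply: leq_trans ht.
(* If the graph induced on [S] were [H]-free, perfectness of [H] would cap its density at
   [clique_dens s.-1], against [dS]. *)
apply: contrapT => HS.
have s1 : (0 < s.-1)%N by move: hs; clear; lia.
have /(@denseP (induced S) R _ s1) := dense_induced dS; apply/negP; rewrite -leNgt.
have -> : s.-1%:R = #|complete_hypergraph 3 s.-1|%:R :> R by rewrite card_ord.
apply: le_trans (lagrangian_le_card _ _); last by rewrite card_ord.
rewrite -cardH -[6 * lagrangian R (complete_hypergraph _ _)]perfH.
by apply: (ub_le_sup (density_ub H)); exists (induced S).
Qed.
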